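(* Let $\rho(r)$ be an arbitrary proximate order, $\mu\in\mathfrak M_\infty(\rho(r))$, and let $K$ be a continuous kernel (function) on $(0,\infty)$ with support contained in some segment $[a,b]\subset(0,\infty)$. Put $$J(r)=\frac1{V(r)}\int_0^\infty K\left(\frac tr\right)d\mu(t).$$ Then $$L(J,\infty)=\left\{\int_0^\infty K(u)\,d\nu(u):\ \nu\in Fr[\mu]\right\}.$$
   Context: Proximate orders: a zero proximate order is a real function $\hat\rho(r)$ on $(0,\infty)$ (possibly undefined at $r=1$) such that $\lim_{r\to\infty}\hat\rho(r)=0$; $\hat\rho(1/r)=-\hat\rho(r)$; $\hat\rho$ is continuously differentiable on $(0,\infty)\setminus\{1\}$; $\lim_{r\to\infty}r\ln r\,\hat\rho'(r)=0$; and $r^{\hat\rho(r)}$ extends continuously to $r=1$ with value $1$. A proximate order is $\rho(r)=\rho+\hat\rho(r)$ with $\rho\in\mathbb R$ and $\hat\rho$ a zero proximate order. Put $V(r)=r^{\rho(r)}$. Radon measures: a real Radon measure on $(0,\infty)$ is $\mu=\mu_1-\mu_2$ with $\mu_1,\mu_2$ mutually singular positive Borel measures, finite on compact subsets of $(0,\infty)$; a complex Radon measure is $\mu_1+i\mu_2$ with $\mu_1,\mu_2$ real Radon measures; $|\mu|$ is the total variation. Wide convergence $\mu_n\to\mu$ means $\int\varphi\,d\mu_n\to\int\varphi\,d\mu$ for every continuous $\varphi$ with compact support in $(0,\infty)$. $\mathfrak M_\infty(\rho(r))$ is the set of Radon measures on $(0,\infty)$ with $\sup_{r\ge1}|\mu|([r,er])/V(r)<\infty$.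 With $\mu_t(E)=\mu(tE)/V(t)$, the Azarin limit set $Fr[\mu]$ is the set of all wide limits $\nu=\lim_{n\to\infty}\mu_{t_n}$ with $t_n\to+\infty$. $L(f,\infty)$ denotes the limit set of a function $f$ as $r\to\infty$: the set of all limits (finite or infinite) $\lim_{n\to\infty}f(r_n)$ with $r_n\to\infty$. *)

(* Defs.v *)
From HB Require Import structures.
From mathcomp Require Import all_boot all_order all_algebra.
From mathcomp Require Import all_classical all_reals all_analysis measurable_realfun.
From mathcomp Require Import complex.
Import Order.TTheory GRing.Theory Num.Theory numFieldNormedType.Exports.
Set Implicit Arguments.
Unset Strict Implicit.
Unset Printing Implicit Defensive.
Local Open Scope classical_set_scope.
Local Open Scope ring_scope.
Local Open Scope complex_scope.

(* [R[i]] does not carry its topology by itself; as a numClosedFieldType it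
   receives the metric topology of the modulus. *)
Definition Cplx (R : realType) : numClosedFieldType := R[i].

Definition half_line {R : realType} : set R := `]0, +oo[%classic.

(* A proximate order may be undefined at 1: its value there is never used,
   since V 1 = 1 `^ rho 1 = 1 in any case. *)
Definition zero_proximate_order (R : realType) (rhat : R -> R) : Prop :=
  [/\ rhat r @[r --> +oo] --> 0,
      (forall r, 0 < r -> r != 1 -> rhat r^-1 = - rhat r),
      (forall r, 0 < r -> r != 1 ->
         derivable rhat r 1 /\ {for r, continuous (derive1 rhat)}),
      r * ln r * derive1 rhat r @[r --> +oo] --> 0
    & r `^ rhat r @[r --> (1 : R)^'] --> (1 : R)].

Definition proximate_order (R : realType) (rho : R -> R) : Prop :=
  exists (rho0 : R) (rhat : R -> R), zero_proximate_order rhat /\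
    forall r, 0 < r -> r != 1 -> rho r = rho0 + rhat r.

Definition V (R : realType) (rho : R -> R) (r : R) : R := r `^ rho r.

(* Measures on (0, +oo) are encoded as Borel measures on R vanishing on
   the complement of (0, +oo). *)
Definition positive_radon (R : realType) (m : {measure set R -> \bar R}) :
    Prop :=
  m (~` half_line) = 0%E /\
  forall C : set R, compact C -> C `<=` half_line -> (m C < +oo)%E.

Definition mutually_singular (R : realType)
    (m1 m2 : {measure set R -> \bar R}) : Prop :=
  exists A : set R, [/\ measurable A, m1 A = 0%E & m2 (~` A) = 0%E].

Record real_radon (R : realType) := RealRadon {
  rpos : {measure set R -> \bar R};
  rneg : {measure set R -> \bar R};
  rpos_radon : positive_radon rpos;
  rneg_radon : positive_radon rneg;
  rpos_rneg_singular : mutually_singular rpos rneg }.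

(* The measure [re_part + i im_part], with [re_part = rpos - rneg] etc. *)
Record radon (R : realType) := Radon {
  re_part : real_radon R;
  im_part : real_radon R }.

Definition relatively_compact (R : realType) (E : set R) : Prop :=
  exists C : set R, [/\ compact C, C `<=` half_line & E `<=` C].

(* Meaningful for measurable relatively compact E, where the four terms are
   finite. *)
Definition radon_val (R : realType) (mu : radon R) (E : set R) : R[i] :=
  (fine (rpos (re_part mu) E) - fine (rneg (re_part mu) E)) +i*
  (fine (rpos (im_part mu) E) - fine (rneg (im_part mu) E)).

(* The values of a Radon measure make sense on relatively compact sets only,
   hence the restriction on the pieces F i.  Allowing finite disjoint families
   in E instead of partitions of E does not change the supremum. *)
Definition total_variation (R : realType) (mu : radon R) (E : set R) :
    \bar R :=
  ereal_sup [set x | exists (n : nat) (F : 'I_n -> set R),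
    [/\ forall i, [/\ measurable (F i), relatively_compact (F i)
                    & F i `<=` E],
        trivIset setT F
      & x = (\sum_(i < n) ComplexField.Normc.normc (radon_val mu (F i)))%:E]].

Definition M_infty (R : realType) (rho : R -> R) : set (radon R) :=
  [set mu | (ereal_sup
    [set (total_variation mu `[r, (expR 1 * r)%R] * ((V rho r)^-1)%:E)%E
      | r in `[1%R, +oo[ : set R] < +oo)%E].

Definition pos_integral (R : realType) (m : {measure set R -> \bar R})
    (f : R -> R[i]) : R[i] :=
  (\int[m]_(x in half_line) complex.Re (f x)) +i*
  (\int[m]_(x in half_line) complex.Im (f x)).

Definition real_integral (R : realType) (m : real_radon R) (f : R -> R[i]) :
    R[i] :=
  pos_integral (rpos m) f - pos_integral (rneg m) f.

Definition radon_integral (R : realType) (mu : radon R) (f : R -> R[i]) :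
    Cplx R :=
  real_integral (re_part mu) f + (0 +i* 1) * real_integral (im_part mu) f.

Definition test_function (R : realType) (phi : R -> Cplx R) : Prop :=
  (forall x, 0 < x -> {for x, continuous phi}) /\
  exists C : set R, [/\ compact C, C `<=` half_line
    & forall x, 0 < x -> ~ C x -> phi x = 0].

Definition wide_cvg (R : realType) (mu_ : nat -> radon R) (nu : radon R) :
    Prop :=
  forall phi : R -> Cplx R, test_function phi ->
    radon_integral (mu_ n) phi @[n --> \oo] --> radon_integral nu phi.

Section dilation.
Context {R : realType}.
Implicit Types (t : R) (m : {measure set R -> \bar R}) (rho : R -> R).

Lemma measurable_divr t : measurable_fun [set: R] (fun x : R => x / t).
Proof. exact: mulrr_measurable. Qed.

(* For t > 0 the preimage of E under x |-> x / t is tE. *)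
Definition dilation t m : set R -> \bar R := pushforward m (fun x => x / t).

Section dilation_measure.
Variables (t : R) (m : {measure set R -> \bar R}).

Let dilation0 : dilation t m set0 = 0%E.
Proof. by rewrite /dilation /pushforward preimage_set0 measure0. Qed.

Let dilation_ge0 A : (0 <= dilation t m A)%E.
Proof. by rewrite /dilation /pushforward. Qed.

Let dilation_sigma_additive : semi_sigma_additive (dilation t m).
Proof.
exact: (@measure_semi_sigma_additive _ _ _
  (measure_function_pushforward__canonical__measure_function_Measure
     m (measurable_divr t))).
Qed.

HB.instance Definition _ := isMeasure.Build _ _ _ (dilation t m)
  dilation0 dilation_ge0 dilation_sigma_additive.

End dilation_measure.

Lemma V_inv_ge0 rho t : 0 <= (V rho t)^-1.
Proof. by rewrite invr_ge0 powR_ge0. Qed.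

Definition azarin_pos rho t m : {measure set R -> \bar R} :=
  mscale (NngNum (V_inv_ge0 rho t)) (dilation t m).

Lemma azarin_pos_radon rho (t : {posnum R}) m :
  positive_radon m -> positive_radon (azarin_pos rho t%:num m).
Proof.
have t0 : 0 < t%:num by [].
move=> [m0 mC]; split=> [|C cC C0].
  rewrite /azarin_pos /= /mscale /= /dilation /pushforward.
  rewrite [X in m X](_ : _ = ~` half_line) ?m0 ?mule0//.
  apply/seteqP; split=> x; rewrite /half_line /= !in_itv /= !andbT;
    by rewrite pmulr_lgt0 ?invr_gt0.
rewrite /azarin_pos /= /mscale /= /dilation /pushforward.
apply: lte_mul_pinfty => //; rewrite ?lee_fin ?V_inv_ge0//.
rewrite [X in m X](_ : _ = (fun x => x * t%:num) @` C).
  apply: mC; first apply: continuous_compact => //.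
    by apply: continuous_subspaceT; exact: mulrr_continuous.
  move=> _ [x Cx <-]; have := C0 x Cx.
  by rewrite /half_line /= !in_itv /= !andbT => x0; rewrite mulr_gt0.
apply/seteqP; split=> [x Cx|_ [x Cx <-]]; last by rewrite /= mulfK ?gt_eqF.
by exists (x / t%:num) => //; rewrite divfK ?gt_eqF.
Qed.

Lemma azarin_pos_singular rho (t : {posnum R}) m1 m2 :
  mutually_singular m1 m2 ->
  mutually_singular (azarin_pos rho t%:num m1) (azarin_pos rho t%:num m2).
Proof.
have t0 : 0 < t%:num by [].
move=> [A [mA m1A m2A]]; exists ((fun x => x * t%:num) @^-1` A).
have E B : (fun x => x / t%:num) @^-1` ((fun x => x * t%:num) @^-1` B) = B.
  by apply/seteqP; split=> x /=; rewrite divfK ?gt_eqF.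
split.
- rewrite -[X in measurable X]setTI; exact: mulrr_measurable.
- by rewrite /azarin_pos /= /mscale /= /dilation /pushforward E m1A mule0.
- rewrite /azarin_pos /= /mscale /= /dilation /pushforward.
  by rewrite -preimage_setC E m2A mule0.
Qed.

End dilation.

Definition azarin_real (R : realType) (rho : R -> R) (t : {posnum R})
    (m : real_radon R) : real_radon R :=
  RealRadon (azarin_pos_radon rho t (rpos_radon m))
            (azarin_pos_radon rho t (rneg_radon m))
            (azarin_pos_singular rho t (rpos_rneg_singular m)).

(* mu_t (E) = mu (tE) / V t *)
Definition azarin (R : realType) (rho : R -> R) (t : {posnum R})
    (mu : radon R) : radon R :=
  Radon (azarin_real rho t (re_part mu)) (azarin_real rho t (im_part mu)).

Definition Fr (R : realType) (rho : R -> R) (mu : radon R) : set (radon R) :=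
  [set nu | exists t : nat -> {posnum R},
    (t n)%:num @[n --> \oo] --> +oo /\
    wide_cvg (fun n => azarin rho (t n) mu) nu].

(* Limits are taken in C with the point at infinity [None] added. *)
Definition limit_set (R : realType) (f : R -> Cplx R) :
    set (one_point_compactification (Cplx R)) :=
  [set z | exists r : nat -> R,
    [/\ forall n, 0 < r n, r n @[n --> \oo] --> +oo
      & (Some (f (r n)) : one_point_compactification (Cplx R))
          @[n --> \oo] --> z]].

Definition J (R : realType) (rho : R -> R) (mu : radon R) (K : R -> Cplx R)
    (r : R) : Cplx R :=
  ((V rho r)^-1)%:C * radon_integral mu (fun t => K (t / r)).

(* Main.v *)
Require Import Defs.
From HB Require Import structures.
From mathcomp Require Import all_boot all_order all_algebra.
From mathcomp Require Import all_classical all_reals all_analysis measurable_realfun.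
From mathcomp Require Import complex ring lra.
Import Order.TTheory GRing.Theory Num.Theory numFieldNormedType.Exports.
Local Open Scope classical_set_scope.
Local Open Scope ring_scope.
Set Implicit Arguments.
Unset Strict Implicit.
Unset Printing Implicit Defensive.

(** The equality rests on two facts.  First, [J r] is exactly the integral of
    [K] against the dilated measure [mu_r] (lemma [J_azarin]), and [K], being
    continuous with compact support, is an admissible test function for wide
    convergence.  So if [mu_(t_n)] tends widely to [nu], then [J (t_n)] tends
    to the integral of [K] against [nu], which is one inclusion.

    Second, the measures [mu_t], for large [t], lie in a widely sequentially
    compact family ([azarin_selection]).  Given [r_n] tending to infinity with
    [J (r_n)] convergent to a finite or infinite [z], a subsequence of
    [mu_(r_n)] has a wide limit [nu], which belongs to [Fr mu]; along it
    [J (r_n)] also converges to the integral of [K] against [nu].  The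
    one-point compactification of the plane is Hausdorff, hence [z] is that
    integral; in particular [z] is never the point at infinity.

    Compactness has three ingredients.
    - Uniform bounds: the growth condition bounds the mass of [r, er] by a
      multiple of [V r], and a logarithmic chain of such intervals covers
      [ar, br].  This needs [V (c r) / V r] to stay bounded for each [c]
      ([proximate_dilation_bound]).  For large [r],
      [V r = r^rho0 * expR (g r)] with [g r = rhat r * ln r]; since [r g'(r)]
      tends to 0, the mean value theorem bounds the increments of [g] between
      [r] and [c r].
    - Helly selection: for each of the four positive parts of [mu_(r_n)], moved
      to the whole line by the logarithm, distribution functions converge at
      all rationals along one diagonal subsequence; the limits define a
      Lebesgue-Stieltjes measure ([helly_selection], [radon_selection]).
    - Jordan decomposition: the limits of the positive and negative parts need
      not be mutually singular, so the common part is removed from both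
      ([jordan_difference]), which does not change their difference. *)

(** * Diagonal extraction *)

(** By Tychonoff the sequence of columns [n |-> (u i n)_i] lives in a compact
    product, hence has a cluster point [l]; the [k]-th index is chosen so that
    the column is within [1/(k+1)] of [l] in its first [k+1] coordinates. *)
Lemma diagonal_extraction (R : realType) (u : nat -> nat -> R) :
  (forall i, exists M, forall n, `|u i n| <= M) ->
  exists2 f : nat -> nat, (forall n, (f n < f n.+1)%N) &
    forall i, exists l : R, u i (f n) @[n --> \oo] --> l.
Proof.
move=> /choice[M uM].
have cptB := @tychonoff nat (fun=> R) (fun i => `[- M i, M i]%classic)
  (fun i => @segment_compact R (- M i) (M i)).
pose un n : prod_topology (fun _ : nat => R) := fun i => u i n.
have unB : (un @ \oo) [set g | forall i, `[- M i, M i]%classic (g i)].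
  by exists 0%N => // n _ i; rewrite /= in_itv/= -ler_norml; exact: uM.
have [l [_ ul]] := cptB (un @ \oo) _ unB.
pose near_l k : set (nat -> R) := [set g | forall i, (i <= k)%N ->
  `|l i - g i| < k.+1%:R^-1].
have near_lP k : nbhs (l : prod_topology (fun _ : nat => R)) (near_l k).
  have H i : nbhs (l : prod_topology (fun _ : nat => R))
      [set g : nat -> R | `|l i - g i| < k.+1%:R^-1].
    have li : nbhs (l i) (ball (l i) k.+1%:R^-1).
      by apply: nbhsx_ballx; rewrite invr_gt0 ltr0n.
    exact: (@proj_continuous nat (fun=> R) i l _ li).
  have FF : Filter (nbhs (l : prod_topology (fun _ : nat => R))).
    exact: nbhs_filter.
  have lF := @filter_forall _ 'I_k.+1
    (fun i (g : prod_topology (fun _ : nat => R)) => `|l i - g i| < k.+1%:R^-1)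
    _ FF (fun i => H i).
  apply: (@filterS _ _ FF _ _ _ lF) => g gF i ik.
  exact: (gF (Ordinal (ik : i < k.+1)%N)).
have next k N : {n | (N < n)%N /\ near_l k (fun i => u i n)}.
  apply: cid.
  have [g [[n Nn <-] gl]] := ul (un @` [set n | (N < n)%N])
     (near_l k) (ex_intro2 _ _ N.+1 I (fun n Hn => imageP _ Hn)) (near_lP k).
  by exists n.
pose f := fix f k := if k is k'.+1 then sval (next k (f k')) else sval (next 0%N 0%N).
have fS n : (f n < f n.+1)%N by rewrite [f n.+1]/=; case: (next _ _) => ? [].
have fl k : near_l k (fun i => u i (f k)).
  by case: k => [|k]; rewrite /f -/f; case: (next _ _) => ? [].
exists f => // i; exists (l i).
apply/cvgrPdist_lt => e e0; near=> n.
apply: (@lt_trans _ _ n.+1%:R^-1).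
  apply: fl; near: n; exact: nbhs_infty_ge.
near: n; exact: near_infty_natSinv_lt (PosNum e0).
Unshelve. all: by end_near. Qed.

(** * Riemann-Stieltjes sums *)

Lemma uniformly_continuous_on_compact (R : realType) (psi : R -> R)
    (C : set R) (e : R) :
  continuous psi -> compact C -> 0 < e ->
  exists2 d, 0 < d &
    forall x y, C x -> `|x - y| < d -> `|psi x - psi y| < e.
Proof.
move=> cpsi cptC e0.
have key x : C x -> \forall x' \near x & d \near (0 : R)^'+,
    forall y, `|x' - y| < d -> `|psi x' - psi y| < e.
  move=> _; have e20 : 0 < e / 2 by rewrite divr_gt0.
  have /cvgrPdist_lt/(_ _ e20)[r /= r0 xr] := cpsi x.
  exists (ball x (r / 2), [set d | d < r / 2]).
    split; first by apply: nbhsx_ballx; rewrite divr_gt0.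
    by apply: nbhs_right_lt; rewrite divr_gt0.
  move=> [x' d] /= [xx' dr] y x'y.
  have xx'r : `|x - x'| < r by apply: (lt_le_trans xx'); lra.
  have xyr : `|x - y| < r.
    rewrite (splitr r) (le_lt_trans (ler_distD x' _ _))// ltrD//.
    exact: (lt_trans x'y).
  rewrite (splitr e) (le_lt_trans (ler_distD (psi x) _ _))// ltrD//.
    by rewrite distrC; exact: xr.
  exact: xr.
have := (compact_near_coveringP C).1 cptC _ _ _ _ key.
move=> nd; near (0 : R)^'+ => d; exists d; first by near: d; exact: nbhs_right_gt.
suff : C `<=` [set x | forall y, `|x - y| < d -> `|psi x - psi y| < e].
  by move=> Cd x y Cx; exact: Cd.
by near: d; exact: nd.
Unshelve. all: by end_near. Qed.

(** The Lebesgue-Stieltjes measure carries the display of the sigma-algebra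
    generated by half-open intervals; this copy is a measure for the default
    Borel structure of [R]. *)
Definition borel_stieltjes (R : realType) (F : cumulative R R) :
  set R -> \bar R := lebesgue_stieltjes_measure F.

HB.instance Definition _ (R : realType) (F : cumulative R R) :=
  isMeasure.Build _ _ _ (borel_stieltjes F)
    (measure0 (lebesgue_stieltjes_measure F))
    (measure_ge0 (lebesgue_stieltjes_measure F))
    (@measure_semi_sigma_additive _ _ _ (lebesgue_stieltjes_measure F)).

Definition has_cdf (R : realType) (m : {measure set R -> \bar R})
    (P : R -> R) :=
  forall x y, x <= y -> m `]x, y]%classic = (P y - P x)%:E.

Lemma borel_stieltjes_cdf (R : realType) (F : cumulative R R) :
  has_cdf (borel_stieltjes F) F.
Proof.
move=> x y xy; rewrite /= /borel_stieltjes /lebesgue_stieltjes_measure.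
rewrite /measure_extension measurable_mu_extE//; last exact: is_ocitv.
by rewrite [LHS](wlength_itv_bnd F false false xy).
Qed.

Lemma nondecreasing_cdf (R : realType) (m : {measure set R -> \bar R})
    (P : R -> R) : has_cdf m P -> {homo P : x y / x <= y}.
Proof.
by move=> mP x y xy; rewrite -subr_ge0 -lee_fin -mP.
Qed.

Lemma continuous_integrable_ocitv (R : realType)
    (m : {measure set R -> \bar R}) (P psi : R -> R) (x y : R) :
  has_cdf m P -> continuous psi ->
  m.-integrable `]x, y]%classic (EFin \o psi).
Proof.
move=> mP cpsi; apply: measurable_bounded_integrable => //.
- have [xy|yx] := leP x y; first by rewrite mP// ltry.
  by rewrite set_itv_ge ?measure0// -leNgt bnd_simp ltW.
- by apply: measurable_funTS; exact: continuous_measurable_fun.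
- have := compact_bounded (continuous_compact
    (continuous_subspaceT cpsi) (@segment_compact R x y)).
  move=> [M [Mreal bM]]; exists M; split => // M' MM' z /= zxy.
  by apply: (bM _ MM'); exists z => //; exact: subset_itv_oc_cc.
Qed.

(** Integral versus Riemann-Stieltjes sum: on each cell, [psi] differs from its
    value at the left end by at most [e]. *)
Lemma stieltjes_sum (R : realType) (m : {measure set R -> \bar R})
    (P psi : R -> R) (t : nat -> R) (e : R) (N : nat) :
  has_cdf m P -> continuous psi -> (forall i, t i <= t i.+1) ->
  (forall i x, (i < N)%N -> t i < x <= t i.+1 -> `|psi x - psi (t i)| <= e) ->
  `|\int[m]_(x in `]t 0%N, t N]) psi x
     - \sum_(i < N) psi (t i) * (P (t i.+1) - P (t i))|
  <= e * (P (t N) - P (t 0%N)).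
Proof.
move=> mP cpsi ht; have t0 n : t 0%N <= t n.
  by elim: n => // n IH; exact: le_trans IH (ht n).
elim: N => [|N IH] osc.
  by rewrite big_ord0 set_itvoc0 Rintegral_set0 !subrr mulr0 normr0.
have iN := continuous_integrable_ocitv (t 0%N) (t N.+1) mP cpsi.
have iN1 := continuous_integrable_ocitv (t N) (t N.+1) mP cpsi.
have UE : `]t 0%N, t N.+1]%classic = `]t 0%N, t N]%classic `|` `]t N, t N.+1].
  by rewrite -itv_bndbnd_setU// bnd_simp.
rewrite big_ord_recr/= UE Rintegral_setU//; [|by rewrite -UE|]; last first.
  apply/disj_setPRL => x /=; rewrite !in_itv/= => /andP[Nx _].
  by apply/negP; rewrite negb_and -!ltNge Nx orbT.
have cell : `|\int[m]_(x in `]t N, t N.+1]) psi x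
    - psi (t N) * (P (t N.+1) - P (t N))| <= e * (P (t N.+1) - P (t N)).
  have mN : fine (m `]t N, t N.+1]%classic) = P (t N.+1) - P (t N) by rewrite mP.
  have icst c : m.-integrable `]t N, t N.+1]%classic (EFin \o cst c).
    exact: continuous_integrable_ocitv mP (fun=> cvg_cst _).
  rewrite -[in leLHS]mN -[in leRHS]mN -!Rintegral_cst// -RintegralB//;
    last exact: icst.
  have cB : continuous (fun x => psi x - psi (t N)).
    by move=> x; apply: cvgB; [exact: cpsi|exact: cvg_cst].
  apply: (le_trans (le_normr_Rintegral _ _)) => //.
    exact: continuous_integrable_ocitv mP cB.
  apply: le_Rintegral => //.
  - apply: (continuous_integrable_ocitv _ _ mP) => x.
    by apply: cvg_norm; exact: cB.
  - exact: icst.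
  - by move=> x /=; rewrite in_itv/=; exact: osc.
rewrite [X in e * X](_ : _ = (P (t N) - P (t 0%N)) + (P (t N.+1) - P (t N))); last by lra.
rewrite [leRHS]mulrDr opprD addrACA; apply: (le_trans (ler_normD _ _)); apply: lerD => //.
by apply: IH => i x iN'; apply: osc; exact: ltnW.
Qed.

(** * Helly's selection theorem *)

(** The extension is the right limit [F x = inf {G q | x < q}].  It may exceed
    [G] at a rational where [G] jumps, hence the strict inequality in the upper
    bound. *)
Lemma rat_cumulative_extension (R : realType) (G : rat -> R) :
  {homo G : p q / p <= q} ->
  exists F : cumulative R R,
    (forall x q, x < ratr q -> F x <= G q) /\
    (forall x q, ratr q <= x -> G q <= F x).
Proof.
move=> ndG.
pose S (x : R) : set R := G @` [set q : rat | x < ratr q].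
have infS x : has_inf (S x).
  split.
    have [q] : exists q : rat, ratr q \in `]x, x + 1[.
      by apply: rat_in_itvoo; rewrite ltrDl.
    rewrite in_itv/= => /andP[xq _]; by exists (G q), q.
  have [p] : exists p : rat, ratr p \in `](x - 1), x[.
    by apply: rat_in_itvoo; rewrite ltrBlDr ltrDl.
  rewrite in_itv/= => /andP[_ px]; exists (G p) => _ [q /= xq <-].
  by apply: ndG; rewrite -(ler_rat R) ltW// (lt_trans px).
pose F x := inf (S x).
have F_le x q : x < ratr q -> F x <= G q.
  by move=> xq; apply: ge_inf; [exact: (infS x).2|exists q].
have F_ge x q : ratr q <= x -> G q <= F x.
  move=> qx; apply: lb_le_inf; first exact: (infS x).1.
  move=> _ [p /= xp <-]; apply: ndG.
  by rewrite -(ler_rat R) (le_trans qx)// ltW.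
have ndF : {homo F : x y / x <= y}.
  move=> x y xy; apply: lb_le_inf; first exact: (infS y).1.
  by move=> _ [p /= yp <-]; apply: F_le; exact: le_lt_trans xy yp.
have rcF x : F y @[y --> x^'+] --> F x.
  apply/cvgrPdist_lt => e e0.
  have [_ [q /= xq <-] Gq] := inf_adherent e0 (infS x).
  near=> y; rewrite ler0_norm ?subr_le0; last first.
    by apply: ndF; apply: ltW; near: y; exact: nbhs_right_gt.
  rewrite opprB ltrBlDl; apply: le_lt_trans Gq; apply: F_le.
  by near: y; exact: nbhs_right_lt.
pose mF := isCumulative.Build R _ R F ndF rcF.
by exists (HB.pack_for (cumulative R R) F mF).
Unshelve. all: by end_near. Qed.

(** Used to show that replacing [G] by [F] in a Stieltjes sum is harmless: the
    increments of [psi], which are small, replace its values. *)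
Lemma abel_summation (R : comPzRingType) (a d : nat -> R) (N : nat) :
  \sum_(i < N) a i * (d i.+1 - d i) =
  a N * d N - a 0%N * d 0%N - \sum_(i < N) (a i.+1 - a i) * d i.+1.
Proof.
elim: N => [|N IH]; first by rewrite !big_ord0 !subrr.
by rewrite !big_ord_recr/= IH; ring.
Qed.

(** Convergence of the distribution functions at all rationals suffices, even
    at jumps of the limit.  All integrals are compared with Stieltjes sums over
    a rational grid.  The sums for [P n] converge to the sum for [G]; the sum
    for [F] differs from the latter, up to sign and after an Abel summation, by
    [\sum_i (psi t_(i+1) - psi t_i) (F t_(i+1) - G t_(i+1))], and
    [0 <= F t_i - G t_i <= G t_(i+1) - G t_i] makes it small. *)
Theorem vague_convergence_of_cdf (R : realType)
    (m : nat -> {measure set R -> \bar R}) (P : nat -> R -> R) (G : rat -> R) :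
  (forall n, has_cdf (m n) (P n)) ->
  (forall q, P n (ratr q) @[n --> \oo] --> G q) ->
  exists F : cumulative R R, forall (psi : R -> R) (A : nat),
    continuous psi -> (forall x, A%:R <= `|x| -> psi x = 0) ->
    \int[m n]_x psi x @[n --> \oo] --> \int[borel_stieltjes F]_x psi x.
Proof.
move=> mP PG.
have ndP n : {homo P n : x y / x <= y} := nondecreasing_cdf (mP n).
have ndG : {homo G : p q / p <= q}.
  move=> p q pq; apply: (ler_cvg_to (PG p) (PG q)).
  by apply: nearW => n; apply: ndP; rewrite ler_rat.
have [F [F_le F_ge]] := rat_cumulative_extension ndG.
exists F => psi A cpsi psi0; apply/cvgrPdist_lt => e e0.
have mF := borel_stieltjes_cdf F.
(* [B] bounds the mass of the grid for [F], for [G] and, for large [n], for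
   [P n]; each of the four approximations then costs at most [e / 4]. *)
pose B := G (A%:R + 1) - G (- A%:R) + 1.
have GB : 0 <= G (A%:R + 1) - G (- A%:R).
  rewrite subr_ge0; apply: ndG; apply: (@le_trans _ _ 0).
    by rewrite oppr_le0 ler0n.
  by rewrite addr_ge0// ler0n.
have B0 : 0 < B by rewrite ltr_pwDr.
pose e1 := e / (4 * B).
have e10 : 0 < e1 by rewrite divr_gt0// mulr_gt0.
have eE : e = e1 * B + e1 * B + e1 * B + e1 * B by rewrite /e1; field; rewrite gt_eqF.
have [d d0 osc] := uniformly_continuous_on_compact cpsi
  (@segment_compact R (- A%:R) A%:R) e10.
have [k kd] : exists k : nat, k.+1%:R^-1 < d.
  near \oo => k; exists k; near: k; exact: near_infty_natSinv_lt (PosNum d0).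
pose r (i : nat) : rat := i%:R / k.+1%:R - A%:R.
pose t i : R := ratr (r i).
(* This number of cells makes [t N = A]. *)
pose N := (2 * A * k.+1)%N.
have tE i : t i = i%:R / k.+1%:R - A%:R.
  by rewrite /t /r rmorphB fmorph_div /= !ratr_nat.
have k0 : (k.+1%:R : R) != 0 by rewrite pnatr_eq0.
have tS i : t i.+1 = t i + k.+1%:R^-1 by rewrite !tE -natr1; field.
have ht i : t i <= t i.+1 by rewrite tS lerDl invr_ge0 ler0n.
have t0 : t 0%N = - A%:R by rewrite tE mul0r sub0r.
have tN : t N = A%:R by rewrite tE /N !natrM; field.
have tr0 : r 0%N = - A%:R by rewrite /r mul0r sub0r.
have rN : r N = A%:R.
  have k0' : (k.+1%:R : rat) != 0 by rewrite pnatr_eq0.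
  by rewrite /r /N !natrM; field.
have t_mono i j : (i <= j)%N -> t i <= t j.
  by move=> /subnK <-; elim: (j - i)%N => // l IH; exact: le_trans IH (ht _).
have rS_le : r N.+1 <= A%:R + 1.
  rewrite -(ler_rat R) [leLHS]tS tN rmorphD rmorph1 /= ratr_nat lerD2l.
  by rewrite invf_le1// ?ler1n ?ltr0n.
have osc_t i x : (i < N)%N -> t i < x <= t i.+1 -> `|psi x - psi (t i)| <= e1.
  move=> iN /andP[ix xi]; rewrite distrC ltW//; apply: osc.
    by rewrite /= in_itv/= -t0 -tN !t_mono// ltnW.
  rewrite ltr0_norm ?subr_lt0// opprB (le_lt_trans _ kd)//.
  by rewrite lerBlDl -tS.
have full (mu : {measure set R -> \bar R}) :
    \int[mu]_x psi x = \int[mu]_(x in `]t 0%N, t N]) psi x.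
  rewrite [RHS]Rintegral_mkcond; apply: eq_Rintegral => x _.
  rewrite patchE; case: ifPn => //; rewrite notin_setE/= in_itv/= => /negP.
  rewrite t0 tN negb_and -leNgt -ltNge => xA; apply: psi0.
  by case/orP: xA => xA; rewrite ler_normr; apply/orP;
    [right; rewrite lerNr|left; exact: ltW].
pose S (Q : nat -> R) := \sum_(i < N) psi (t i) * (Q i.+1 - Q i).
have SPG : S (P n \o t) @[n --> \oo] --> S (G \o r).
  apply: cvg_big => [|i _]; first exact: add_continuous.
  by apply: cvgMr; apply: cvgB; exact: PG.
have SGF : `|S (G \o r) - S (F \o t)| <= e1 * B.
  pose D i := F (t i) - G (r i).
  have psiN : psi (t N) = 0 by apply: psi0; rewrite tN ger0_norm// ler0n.
  have psi00 : psi (t 0%N) = 0 by apply: psi0; rewrite t0 normrN ger0_norm// ler0n.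
  rewrite distrC -sumrB (eq_bigr (fun i : 'I_N => psi (t i) * (D i.+1 - D i))); last first.
    by move=> i _; rewrite /D /=; ring.
  rewrite (abel_summation (psi \o t) D)/= psiN psi00 !mul0r subrr sub0r normrN.
  apply: (le_trans (ler_norm_sum _ _ _)).
  apply: (@le_trans _ _ (\sum_(i < N) e1 * (G (r i.+2) - G (r i.+1)))).
    apply: ler_sum => i _; rewrite normrM; apply: ler_pM => //.
      by apply: osc_t => //; rewrite lexx andbT tS ltrDl invr_gt0 ltr0n.
    rewrite /D ger0_norm ?subr_ge0 ?F_ge// lerD2r F_le//.
    by rewrite [ltRHS]tS ltrDl invr_gt0 ltr0n.
  rewrite -mulr_sumr; apply: ler_wpM2l; first exact: ltW.
  rewrite -(big_mkord xpredT (fun i => G (r i.+2) - G (r i.+1))).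
  rewrite (telescope_sumr (fun i => G (r i.+1)))//.
  rewrite /B; apply: (@le_trans _ _ (G (A%:R + 1) - G (- A%:R))); last by rewrite lerDl.
  by rewrite lerB// ndG// -tr0 -(ler_rat R) [leLHS]/(t 0%N) t_mono.
have FB : F (t N) - F (t 0%N) <= B.
  apply: (@le_trans _ _ (G (A%:R + 1) - G (- A%:R))); last by rewrite lerDl.
  apply: lerB.
    by apply: F_le; rewrite tN rmorphD rmorph1 /= ratr_nat ltrDl.
  by apply: F_ge; rewrite -tr0.
have PB : \forall n \near \oo, P n (t N) - P n (t 0%N) <= B.
  have : P n (t N) - P n (t 0%N) @[n --> \oo] --> G (r N) - G (r 0%N).
    by apply: cvgB; exact: PG.
  move=> /cvgrPdist_lt/(_ 1 ltr01); apply: filterS => n.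
  rewrite distrC => /ltW /(le_trans (ler_norm _)); rewrite lerBlDl => /le_trans; apply.
  by rewrite /B rN tr0 lerD2r lerB// ndG// lerDl.
have SPGn : \forall n \near \oo, `|S (G \o r) - S (P n \o t)| < e1 * B.
  by move/cvgrPdist_lt : SPG; apply; rewrite mulr_gt0.
near=> n.
have In : `|\int[m n]_x psi x - S (P n \o t)| <= e1 * B.
  rewrite full; apply: (le_trans (stieltjes_sum (mP n) cpsi ht osc_t)).
  by rewrite ler_wpM2l//; [exact: ltW|near: n].
have IF : `|\int[borel_stieltjes F]_x psi x - S (F \o t)| <= e1 * B.
  rewrite full; apply: (le_trans (stieltjes_sum mF cpsi ht osc_t)).
  by rewrite ler_wpM2l//; exact: ltW.
have SPGn' : `|S (G \o r) - S (P n \o t)| < e1 * B by near: n.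
rewrite eE; move: In IF SGF SPGn'; rewrite !ler_norml !ltr_norml; lra.
Unshelve. all: by end_near. Qed.

(** The measures may have infinite mass near minus infinity, so distribution
    functions are normalized to vanish at 0; one of the two terms is always
    the mass of the empty set. *)
Definition centered_cdf (R : realType) (m : {measure set R -> \bar R})
    (x : R) : R :=
  fine (m `]0, x]%classic) - fine (m `]x, 0]%classic).

Lemma has_cdf_centered (R : realType) (m : {measure set R -> \bar R}) :
  (forall x y, (m `]x, y]%classic < +oo)%E) -> has_cdf m (centered_cdf m).
Proof.
move=> mfin x y xy.
have fin a b : m `]a, b]%classic \is a fin_num by rewrite ge0_fin_numE.
have add a b c : a <= b -> b <= c ->
    fine (m `]a, c]%classic) = fine (m `]a, b]%classic) + fine (m `]b, c]%classic).
  move=> ab bc; rewrite -fineD// -measureU//; last first.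
    apply/disj_set2P/disj_setPRL => z /=; rewrite !in_itv/= => /andP[bz _].
    by apply/negP; rewrite negb_and -!ltNge bz orbT.
  by rewrite -itv_bndbnd_setU// bnd_simp.
have emp a b : b <= a -> m `]a, b]%classic = 0%E.
  by move=> ba; rewrite set_itv_ge ?measure0// -leNgt bnd_simp.
rewrite -[LHS]fineK// /centered_cdf; congr EFin.
have [x0|x0] := leP 0 x.
  by rewrite (emp x 0)// (emp y 0) ?(le_trans x0)// (add 0 x y)//=; ring.
have [y0|y0] := leP 0 y.
  by rewrite (emp 0 x) ?(emp y 0)// ?ltW// (add x 0 y)//= ?ltW//; ring.
by rewrite (emp 0 x) ?(emp 0 y) ?(add x y 0)//= ?ltW//; ring.
Qed.

(** The subsequence is common to all members of a countable family, so that the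
    four parts of a complex measure can be treated at once. *)
Theorem helly_selection (R : realType) (I : countType)
    (m : I -> nat -> {measure set R -> \bar R}) :
  (forall i (A : nat), exists M : R, forall n,
     (m i n (`](- A%:R), A%:R]%classic)%R <= M%:E)%E) ->
  exists2 f : nat -> nat, (forall n, (f n < f n.+1)%N) &
    forall i, exists F : cumulative R R, forall (psi : R -> R) (A : nat),
      continuous psi -> (forall x, A%:R <= `|x| -> psi x = 0) ->
      \int[m i (f n)]_x psi x @[n --> \oo] --> \int[borel_stieltjes F]_x psi x.
Proof.
move=> mbd.
have sub (x y : R) (A : nat) : `|x| <= A%:R -> `|y| <= A%:R ->
    `]x, y]%classic `<=` `](- A%:R), A%:R]%classic.
  rewrite !ler_norml => /andP[Ax _] /andP[_ yA] z /=.
  by rewrite !in_itv/= => /andP[xz zy]; rewrite (le_lt_trans Ax)//= (le_trans zy).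
have bound (x : R) : exists A : nat, `|x| <= A%:R.
  by exists (Num.bound `|x|); rewrite ltW// archi_boundP.
have cdf i n : has_cdf (m i n) (centered_cdf (m i n)).
  apply: has_cdf_centered => x y.
  have [A] := bound (`|x| + `|y|); rewrite ger0_norm ?addr_ge0// => xyA.
  have [M mM] := mbd i A; apply: le_lt_trans (ltry M); apply: le_trans (mM n).
  apply: le_measure; rewrite ?inE//; apply: sub; apply: le_trans xyA;
    by rewrite ?lerDl ?lerDr.
(* The countably many pairs (index, rational) are enumerated by [pickle]. *)
pose u k n : R := if unpickle k is Some (i, q)
  then centered_cdf (m i n) (ratr q) else 0.
have ubd k : exists M, forall n, `|u k n| <= M.
  rewrite /u; case: unpickle => [[i q]|]; last by exists 0 => n; rewrite normr0.
  have [A qA] := bound (ratr q); have [M mM] := mbd i A.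
  exists (M + M) => n.
  have fM x y : `|x| <= A%:R -> `|y| <= A%:R ->
      0 <= fine (m i n `]x, y]%classic) <= M.
    move=> xA yA; rewrite fine_ge0//= -lee_fin fineK; last first.
      rewrite ge0_fin_numE//; apply: le_lt_trans (ltry M).
      apply: le_trans (mM n); apply: le_measure; rewrite ?inE//; exact: sub.
    by apply: le_trans (mM n); apply: le_measure; rewrite ?inE//; exact: sub.
  have A0 : `|0 : R| <= A%:R by rewrite normr0.
  rewrite /centered_cdf (le_trans (ler_normB _ _))// !ger0_norm ?lerD//;
    by case/andP: (fM _ _ A0 qA) => //; case/andP: (fM _ _ qA A0).
have [f fS ucvg] := diagonal_extraction ubd.
exists f => // i.
have /choice[G PG] : forall q : rat, exists l : R,
    centered_cdf (m i (f n)) (ratr q) @[n --> \oo] --> l.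
  move=> q; have [l] := ucvg (pickle (i, q)).
  by rewrite /u pickleK; exists l.
exact: vague_convergence_of_cdf (fun n => cdf i (f n)) PG.
Qed.

(** * Selection for Radon measures on the half-line *)

Definition image_measure (R : realType) (f : R -> R)
    (mf : measurable_fun setT f) (m : {measure set R -> \bar R}) :
    {measure set R -> \bar R} :=
  measure_function_pushforward__canonical__measure_function_Measure m mf.

Lemma Rintegral_image (R : realType) (f : R -> R)
    (mf : measurable_fun setT f) (m : {measure set R -> \bar R})
    (D : set R) (g : R -> R) :
  measurable D -> measurable_fun D g ->
  \int[image_measure mf m]_(x in D) g x = \int[m]_(x in f @^-1` D) g (f x).
Proof.
move=> mD mg; congr fine; rewrite [LHS]integralE [RHS]integralE.
have mgE : measurable_fun D (EFin \o g) by exact/measurable_EFinP.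
congr (_ - _)%E.
  rewrite (ge0_integral_pushforward mf)//;
    last exact/measurable_funepos.
  by apply: eq_integral => x _; rewrite !unlock.
rewrite (ge0_integral_pushforward mf)//;
    last exact/measurable_funeneg.
by apply: eq_integral => x _; rewrite !unlock.
Qed.

Lemma half_lineE (R : realType) (x : R) : half_line x = (0 < x).
Proof. by rewrite /half_line /= in_itv/= andbT. Qed.

(** The image of [C] under [ln] is compact, hence bounded. *)
Lemma compact_half_line (R : realType) (C : set R) :
  compact C -> C `<=` half_line ->
  exists A : nat, C `<=` `[expR (- A%:R), expR A%:R].
Proof.
move=> cC C0.
have lnC : compact (@ln R @` C).
  apply: continuous_compact => //; apply: continuous_in_subspaceT => x.
  by rewrite inE => /C0; rewrite /half_line /= in_itv/= andbT => /continuous_ln.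
have [M [_ bM]] := compact_bounded lnC.
exists (Num.bound `|M + 1|) => x Cx; have x0 : 0 < x.
  by move: (C0 _ Cx); rewrite /half_line /= in_itv/= andbT.
have /= := bM (M + 1) _ (ln x) (ex_intro2 _ _ x Cx erefl); rewrite ltrDl ltr01.
move=> /(_ isT) lnxM.
have : `|ln x| <= (Num.bound `|M + 1|)%:R.
  by apply: (le_trans lnxM); apply: (le_trans (ler_norm _)); rewrite ltW// archi_boundP.
rewrite ler_norml => /andP[h1 h2]; rewrite /= in_itv/=.
by rewrite -[x]lnK ?posrE// !ler_expR h1.
Qed.

Definition bump (R : realType) (phi : R -> R) :=
  (forall x, 0 < x -> {for x, continuous phi}) /\
  exists C, [/\ compact C, C `<=` half_line &
    forall x, 0 < x -> ~ C x -> phi x = 0].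

Lemma measurable_half_line (R : realType) : measurable (@half_line R).
Proof. exact: measurable_itv. Qed.

Lemma bump_measurable (R : realType) (phi : R -> R) :
  bump phi -> measurable_fun half_line phi.
Proof.
move=> [cphi _]; apply: open_continuous_measurable_fun.
  exact: interval_open.
by move=> x; rewrite inE /half_line /= in_itv/= andbT; exact: cphi.
Qed.

(** Helly selection on the line, transported by [ln] and [expR]. *)
Theorem radon_selection (R : realType) (I : countType)
    (m : I -> nat -> {measure set R -> \bar R}) :
  (forall i n, positive_radon (m i n)) ->
  (forall i a b, 0 < a -> exists M : R, forall n, (m i n `[a, b]%classic <= M%:E)%E) ->
  exists2 f : nat -> nat, (forall n, (f n < f n.+1)%N) &
    forall i, exists2 mu : {measure set R -> \bar R}, positive_radon mu &
      forall phi, bump phi ->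
        \int[m i (f n)]_(x in half_line) phi x @[n --> \oo] -->
        \int[mu]_(x in half_line) phi x.
Proof.
move=> mR mbd.
pose mlog i n := image_measure (@measurable_ln R) (m i n).
have [|f fS sel] := @helly_selection R I mlog.
  move=> i A; have [M mM] := mbd i (expR (- A%:R)) (expR A%:R) (expR_gt0 _).
  exists M => n; apply: le_trans (mM n).
  have -> : m i n `[expR (- A%:R), expR A%:R]%classic =
    m i n (`[expR (- A%:R), expR A%:R]%classic `|` ~` half_line).
    rewrite [RHS]measureU0//; last by have [] := mR i n.
    by apply: measurableC; exact: measurable_half_line.
  rewrite /mlog /image_measure /= /pushforward; apply: le_measure; rewrite ?inE.
  - rewrite -[X in measurable X]setTI; exact: measurable_ln.
  - apply: measurableU => //; apply: measurableC; exact: measurable_half_line.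
  - move=> x /=; rewrite in_itv/= => /andP[h1 h2].
    have [x0|x0] := ltP 0 x; last first.
      by right; rewrite /setC /= half_lineE; apply/negP; rewrite -leNgt.
    by left; rewrite /= in_itv/=; rewrite -[x]lnK ?posrE// !ler_expR h2 ltW.
exists f => // i; have [F Fcvg] := sel i.
exists (image_measure (@measurable_expR R) (borel_stieltjes F)).
  split=> [|C cC C0].
    rewrite /image_measure /= /pushforward (_ : _ @^-1` _ = set0) ?measure0//.
    by apply/seteqP; split=> x //=; rewrite /half_line /= in_itv/= expR_gt0.
  have [A CA] := compact_half_line cC C0.
  rewrite /image_measure /= /pushforward.
  have := borel_stieltjes_cdf F (_ : - A.+1%:R <= A%:R).
  have AA : - A.+1%:R <= A%:R :> R by rewrite (@le_trans _ _ 0)// oppr_le0.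
  move=> /(_ AA) mA.
  apply: (@le_lt_trans _ _ (borel_stieltjes F `](- A.+1%:R), A%:R]%classic)).
    apply: le_measure; rewrite ?inE//.
      rewrite -[X in measurable X]setTI; apply: measurable_expR => //.
      exact: compact_measurable.
    move=> x /CA /=; rewrite !in_itv/= !ler_expR => /andP[h1 ->]; rewrite andbT.
    by apply: lt_le_trans h1; rewrite ltrN2 ltr_nat.
  by rewrite mA ltry.
move=> phi phib; have mphi := bump_measurable phib.
have [cphi [C [cC C0 phi0]]] := phib.
have [A CA] := compact_half_line cC C0.
have ce : continuous (phi \o expR).
  move=> x; apply: continuous_comp; first exact: continuous_expR.
  exact: cphi (expR_gt0 x).
have := Fcvg (phi \o expR) A.+1 ce.
have e0 x : A.+1%:R <= `|x| -> (phi \o expR) x = 0.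
  move=> Ax; apply: phi0; first exact: expR_gt0.
  move=> /CA /=; rewrite in_itv/= !ler_expR -ler_norml => xA.
  by have := le_trans Ax xA; rewrite ler_nat ltnn.
move=> /(_ e0).
have mce : measurable_fun setT (phi \o expR) by exact: continuous_measurable_fun.
have -> : \int[image_measure (@measurable_expR R) (borel_stieltjes F)]_(x in half_line)
    phi x = \int[borel_stieltjes F]_x (phi \o expR) x.
  rewrite Rintegral_image//; last exact: measurable_half_line.
  congr (\int[_]_(x in _) _).
  by apply/seteqP; split=> x //= _; rewrite /half_line /= in_itv/= expR_gt0.
have -> : (fun n => \int[m i (f n)]_(x in half_line) phi x) =
          (fun n => \int[mlog i (f n)]_x (phi \o expR) x).
  apply/funext => n; rewrite /mlog Rintegral_image// preimage_setT.
  rewrite Rintegral_mkcond; congr fine; apply: ae_eq_integral => //.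
  - apply/measurable_EFinP; apply/(measurable_restrictT _ _).1 => //.
    exact: measurable_half_line.
  - apply/measurable_EFinP.
    exact: measurableT_comp mce (@measurable_ln R).
  - exists (~` half_line); split; first by apply: measurableC; exact: measurable_half_line.
      by have [] := mR i (f n).
    move=> x /= xN hx; apply: xN => _; rewrite patchE mem_set//= lnK// posrE.
    by move: hx; rewrite /half_line /= in_itv/= andbT.
by [].
Qed.

(** * Jordan decomposition of a difference of sigma-finite measures *)

(** Jordan decomposition of [m1 - m2], which is not a charge when both measures
    are infinite.  It is carried out on each piece of a countable partition
    into sets of finite measure, and the parts are added up.  The conclusion is
    stated additively to avoid differences of infinite quantities. *)
Theorem jordan_difference d (T : measurableType d) (R : realType)
    (m1 m2 : {measure set T -> \bar R}) (F : nat -> set T) :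
  (forall k, measurable (F k)) -> \bigcup_k F k = setT ->
  (forall k, m1 (F k) < +oo)%E -> (forall k, m2 (F k) < +oo)%E ->
  exists k1 k2 : {measure set T -> \bar R},
    [/\ forall E, measurable E -> (k1 E <= m1 E)%E,
        forall E, measurable E -> (k2 E <= m2 E)%E,
        exists A, [/\ measurable A, k1 A = 0%E & k2 (~` A) = 0%E] &
        forall E, measurable E -> (m1 E + k2 E = m2 E + k1 E)%E].
Proof.
move=> mF FT m1F m2F; pose D := seqDU F.
have mD k : measurable (D k) by exact: seqDU_measurable.
have tD : trivIset setT D by exact: trivIset_seqDU.
have DT : \bigcup_k D k = setT by rewrite -seqDU_bigcup_eq.
have Dfin (m : {measure set T -> \bar R}) k : (m (F k) < +oo)%E -> (m (D k) < +oo)%E.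
  by apply: le_lt_trans; apply: le_measure; rewrite ?inE//; exact: subset_seqDU.
have D1 k := Dfin m1 k (m1F k); have D2 k := Dfin m2 k (m2F k).
pose nu k := cadd (charge_of_finite_measure (mfrestr (mD k) (D1 k)))
  (copp (charge_of_finite_measure (mfrestr (mD k) (D2 k)))).
have nuE k E : nu k E = (m1 (E `&` D k) - m2 (E `&` D k))%E by [].
have hahn k : {PN : set T * set T | hahn_decomposition (nu k) PN.1 PN.2}.
  by apply: cid; have [P [N PN]] := Hahn_decomposition (nu k); exists (P, N).
pose P k := (sval (hahn k)).1; pose N k := (sval (hahn k)).2.
have mP k : measurable (P k) by case: (svalP (hahn k)) => -[].
have mN k : measurable (N k) by case: (svalP (hahn k)) => _ [].
have PN0 k : P k `&` N k = set0 by case: (svalP (hahn k)).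
pose jp k : {measure set T -> \bar R} := jordan_pos (svalP (hahn k)).
pose jn k : {measure set T -> \bar R} := jordan_neg (svalP (hahn k)).
have jpE k E : measurable E -> jp k E = nu k (E `&` P k).
  by move=> mE; rewrite [LHS]jordan_posE cjordan_posE /crestr0 mem_set.
have jnE k E : measurable E -> jn k E = (- nu k (E `&` N k))%E.
  by move=> mE; rewrite [LHS]jordan_negE cjordan_negE /crestr0 mem_set.
have fin1 k E : measurable E -> m1 (E `&` D k) \is a fin_num.
  move=> mE; rewrite ge0_fin_numE//; apply: le_lt_trans (D1 k).
  by apply: le_measure; rewrite ?inE//; first [exact: measurableI | exact: subIsetr].
have fin2 k E : measurable E -> m2 (E `&` D k) \is a fin_num.
  move=> mE; rewrite ge0_fin_numE//; apply: le_lt_trans (D2 k).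
  by apply: le_measure; rewrite ?inE//; first [exact: measurableI | exact: subIsetr].
have balance k E : measurable E ->
    (m1 (E `&` D k) + jn k E = m2 (E `&` D k) + jp k E)%E.
  move=> mE; have bal : nu k E = (jp k E - jn k E)%E.
    apply: (eq_trans (jordan_decomp (svalP (hahn k)) mE)).
    by rewrite /cadd /= cscaleN1.
  have fp : jp k E \is a fin_num by exact: fin_num_measure.
  have fn : jn k E \is a fin_num by exact: fin_num_measure.
  move: bal; rewrite nuE -(fineK fp) -(fineK fn).
  rewrite -(fineK (fin1 _ _ mE)) -(fineK (fin2 _ _ mE)).
  rewrite -!EFinN -!EFinD => -[bal]; congr EFin; lra.
have sumD (m : {measure set T -> \bar R}) E : measurable E ->
    m E = (\sum_(0 <= k <oo) m (E `&` D k))%E.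
  move=> mE; rewrite -[in LHS](setIT E) -DT setI_bigcupr.
  rewrite measure_semi_bigcup//; first by move=> k; exact: measurableI.
    exact: trivIset_setIl.
  by apply: bigcup_measurable => k _; exact: measurableI.
exists (mseries jp 0), (mseries jn 0); split.
- move=> E mE; rewrite (sumD m1)// /= /mseries; apply: lee_nneseries => // k _.
  rewrite jpE// nuE; apply: (@le_trans _ _ (m1 (E `&` P k `&` D k))%E).
    by rewrite leeBlDr ?fin2 ?leeDl//; exact: measurableI.
  apply: le_measure; rewrite ?inE;
    [by apply: measurableI => //; exact: measurableI|exact: measurableI|].
  by apply: setSI; exact: subIsetl.
- move=> E mE; rewrite (sumD m2)// /= /mseries; apply: lee_nneseries => // k _.
  rewrite jnE// nuE; apply: (@le_trans _ _ (m2 (E `&` N k `&` D k))%E).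
    have mEN : measurable (E `&` N k) by exact: measurableI.
    by rewrite fin_num_oppeB ?fin2// addeC leeBlDr ?fin1// leeDl.
  apply: le_measure; rewrite ?inE;
    [by apply: measurableI => //; exact: measurableI|exact: measurableI|].
  by apply: setSI; exact: subIsetl.
- have mA : measurable (\bigcup_k (D k `&` N k)).
    by apply: bigcup_measurable => k _; exact: measurableI.
  (* On the piece [D k], the negative set [N k] is null for the positive part;
     distinct pieces do not interfere because they are disjoint. *)
  exists (\bigcup_k (D k `&` N k)); split => //.
  + rewrite /= /mseries eseries0// => k _ _; rewrite jpE// nuE.
    rewrite (_ : _ `&` D k = set0) ?measure0 ?sube0//.
    apply/seteqP; split => // x [[[j _ [Djx Njx]] Pkx] Dkx].
    have jk : j = k by apply: (tD j k) => //; exists x.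
    by rewrite -(PN0 k); split => //; rewrite -jk.
  + rewrite /= /mseries eseries0// => k _ _; rewrite jnE//; last exact: measurableC.
    rewrite nuE (_ : _ `&` D k = set0) ?measure0 ?sube0 ?oppe0//.
    by apply/seteqP; split => // x [[nA Nkx] Dkx]; apply: nA; exists k.
- move=> E mE; rewrite (sumD m1)// (sumD m2)// /= /mseries -!nneseriesD//.
  by apply: eq_eseriesr => k _; exact: balance.
Qed.

(** * Growth of V under dilations *)

Lemma V_expR (R : realType) (rho : R -> R) (r : R) :
  0 < r -> V rho r = expR (rho r * ln r).
Proof. by move=> r0; rewrite /V /powR gt_eqF. Qed.

Lemma V_gt0 (R : realType) (rho : R -> R) (r : R) : 0 < r -> 0 < V rho r.
Proof. by move=> r0; rewrite V_expR// expR_gt0. Qed.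

(** [g = rhat * ln] has [x g'(x) = x ln x rhat'(x) + rhat x], which tends to 0;
    beyond the point where it is at most 1 in modulus, the mean value theorem
    gives the bound. *)
Lemma slow_variation_rhat (R : realType) (rhat : R -> R) :
  zero_proximate_order rhat ->
  exists2 r0, 1 < r0 & forall x y, r0 <= x -> x <= y ->
    `|rhat y * ln y - rhat x * ln x| <= (y - x) / x.
Proof.
move=> [rhat0 _ rhatD rhatD0 _].
pose dg x := 'D_1 rhat x * ln x + rhat x * x^-1.
have : x * ln x * derive1 rhat x + rhat x @[x --> +oo] --> (0 + 0 : R) by exact: cvgD.
rewrite addr0 => /cvgrPdist_le/(_ 1 ltr01)[r1 [_ r1P]].
exists (Num.max r1 1 + 1); first by rewrite ltr_pwDr// le_max lexx orbT.
move=> x y r0x xy.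
have x1 : 1 < x by apply: lt_le_trans r0x; rewrite ltr_pwDr// le_max lexx orbT.
have xr1 : r1 < x by apply: lt_le_trans r0x; rewrite ltr_pwDr// le_max lexx.
have dgP (z : R) : 1 < z -> is_derive z 1 (fun x => rhat x * ln x) (dg z).
  move=> z1; have z0 : 0 < z by rewrite (lt_trans ltr01).
  have zn1 : z != 1 by rewrite gt_eqF.
  have [dz _] := rhatD z z0 zn1.
  have h1 : is_derive z 1 rhat ('D_1 rhat z) by apply: DeriveDef.
  have h2 : is_derive z 1 (@ln R) z^-1 by exact: is_derive1_ln.
  apply: is_derive_eq; rewrite /dg /GRing.scale/=; ring.
move: xy; rewrite le_eqVlt => /orP[/eqP<-|xy]; first by rewrite !subrr normr0 mul0r.
have [c cxy ->] : exists2 c, c \in `]x, y[ &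
    rhat y * ln y - rhat x * ln x = dg c * (y - x).
  apply: (@MVT _ (fun x => rhat x * ln x) dg) => // [z|].
    by rewrite in_itv/= => /andP[xz _]; apply: dgP; exact: lt_trans xz.
  apply: derivable_within_continuous => z; rewrite in_itv/= => /andP[xz _].
  by have [] := dgP z (lt_le_trans x1 xz).
move: cxy; rewrite in_itv/= => /andP[xc cy].
have c0 : 0 < c by rewrite (lt_trans _ xc)// (lt_trans ltr01).
have := r1P c (lt_trans xr1 xc); rewrite sub0r normrN => cdg.
have {cdg} : `|c * dg c| <= 1.
  apply: le_trans cdg; rewrite /dg derive1E.
  by rewrite (_ : c * _ = c * ln c * 'D_1 rhat c + rhat c)//; field; rewrite gt_eqF.
rewrite normrM (gtr0_norm c0) => cdg.
rewrite normrM [`|y - x|]gtr0_norm ?subr_gt0// mulrC.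
apply: ler_wpM2l; first by rewrite subr_ge0 ltW.
apply: (@le_trans _ _ c^-1); last by rewrite lef_pV2 ?posrE// ?ltW// (lt_trans ltr01).
by rewrite -[leRHS]mul1r ler_pdivlMr// mulrC.
Qed.

(** [ln (V (c r) / V r) = rho0 ln c + g (c r) - g r], and the increment of [g]
    is at most [c - 1] or [1/c - 1] according to which of [r] and [c r] is
    smaller. *)
Lemma proximate_dilation_bound (R : realType) (rho : R -> R) (c : R) :
  proximate_order rho -> 0 < c ->
  exists M r0 : R, 0 < r0 /\ forall r, r0 <= r -> V rho (c * r) <= M * V rho r.
Proof.
move=> [rho0 [rhat [rhatP rhoE]]] c0.
have [r0 r01 slow] := slow_variation_rhat rhatP.
have rr0 : 0 < r0 by rewrite (lt_trans ltr01).
exists (expR (rho0 * ln c + c + c^-1)), (r0 + r0 / c).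
have rc0 : 0 < r0 / c by rewrite divr_gt0.
split; first by rewrite addr_gt0.
move=> r hr.
have r0r : r0 <= r by rewrite (le_trans _ hr)// lerDl ltW.
have r0cr : r0 <= c * r.
  by rewrite mulrC -ler_pdivrMr// (le_trans _ hr)// lerDr ltW.
have r_gt0 : 0 < r by exact: lt_le_trans r0r.
have cr_gt0 : 0 < c * r by exact: lt_le_trans r0cr.
have rn1 : r != 1 by rewrite gt_eqF// (lt_le_trans r01).
have crn1 : c * r != 1 by rewrite gt_eqF// (lt_le_trans r01).
rewrite !V_expR// -expRD ler_expR !rhoE// !mulrDl {1}lnM ?posrE//.
have : `|rhat (c * r) * ln (c * r) - rhat r * ln r| <= c + c^-1.
  have [rcr|/ltW crr] := leP r (c * r).
    apply: (le_trans (slow _ _ r0r rcr)).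
    rewrite (_ : (c * r - r) / r = c - 1); last by field; rewrite gt_eqF.
    by rewrite lerD2l (@le_trans _ _ 0) ?lerN10// invr_ge0 ltW.
  rewrite distrC; apply: (le_trans (slow _ _ r0cr crr)).
  rewrite (_ : (r - c * r) / (c * r) = c^-1 - 1); last by field; rewrite !gt_eqF.
  by rewrite addrC lerD2r (@le_trans _ _ 0) ?lerN10// ltW.
rewrite ler_norml => /andP[_ h]; move: h; rewrite mulrDr; lra.
Qed.

(** * Masses of the components of a Radon measure *)

(** The four positive measures that make up a complex Radon measure are indexed
    by two booleans: imaginary part or not, negative part or not. *)
Definition real_component (R : realType) (mu : radon R) (im : bool) :
  real_radon R := if im then im_part mu else re_part mu.

Definition component (R : realType) (mu : radon R) (i : bool * bool) :
    {measure set R -> \bar R} :=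
  if i.2 then rneg (real_component mu i.1) else rpos (real_component mu i.1).

Lemma component_radon (R : realType) (mu : radon R) (i : bool * bool) :
  positive_radon (component mu i).
Proof. by rewrite /component; case: i.2; [exact: rneg_radon|exact: rpos_radon]. Qed.

Lemma itvcc_half_line (R : realType) (x y : R) :
  0 < x -> `[x, y]%classic `<=` half_line.
Proof.
by move=> x0 z /=; rewrite in_itv half_lineE /= => /andP[/(lt_le_trans x0)].
Qed.

Lemma radon_fin_num (R : realType) (m : {measure set R -> \bar R})
    (x y : R) (B : set R) :
  positive_radon m -> 0 < x -> measurable B -> B `<=` `[x, y]%classic ->
  m B \is a fin_num.
Proof.
move=> [_ mC] x0 mB Bxy; rewrite ge0_fin_numE//.
apply: le_lt_trans (mC _ (@segment_compact R x y) (itvcc_half_line x0)).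
by apply: le_measure; rewrite ?inE.
Qed.

(** By mutual singularity the component is carried by a set on which the
    opposite component vanishes; this single set, as a one-element family, is
    already a competitor in the supremum. *)
Lemma component_le_total_variation (R : realType) (mu : radon R)
    (i : bool * bool) (x y : R) :
  0 < x -> (component mu i `[x, y]%classic <= Defs.total_variation mu `[x, y]%classic)%E.
Proof.
move=> x0.
have [B [mB Bxy own opp]] : exists B : set R, [/\ measurable B, B `<=` `[x, y]%classic,
    component mu i B = component mu i `[x, y]%classic &
    component mu (i.1, ~~ i.2) B = 0%E].
  have [A [mA pA nA]] := rpos_rneg_singular (real_component mu i.1).
  have mA' : measurable (if i.2 then A else ~` A) by case: i.2 => //; exact: measurableC.
  exists (`[x, y]%classic `&` (if i.2 then A else ~` A)); split.
  - exact: measurableI.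
  - exact: subIsetl.
  - rewrite -[`[x, y]%classic in RHS](setIT) -(setUv (if i.2 then A else ~` A)).
    rewrite setIUr [RHS]measureU0//; try by apply: measurableI => //; exact: measurableC.
    apply: (@subset_measure0 _ _ _ _ _ (~` (if i.2 then A else ~` A))).
    + by apply: measurableI => //; exact: measurableC.
    + exact: measurableC.
    + exact: subIsetr.
    + by rewrite /component; case: i.2; rewrite ?setCK.
  - apply: (@subset_measure0 _ _ _ _ _ (if i.2 then A else ~` A)) => //.
    + exact: measurableI.
    + by rewrite /component/=; case: i.2.
have fB := radon_fin_num (component_radon mu i) x0 mB Bxy.
apply: (@le_trans _ _ (ComplexField.Normc.normc (radon_val mu B))%:E); last first.
  apply: ereal_sup_ubound => /=; exists 1%N, (fun=> B); split.
  - move=> _; split=> //; exists `[x, y]%classic; split=> //.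
      exact: segment_compact.
    exact: itvcc_half_line.
  - by move=> j k _ _ _; rewrite !ord1.
  - by rewrite big_ord1.
rewrite -own -(fineK fB) lee_fin.
have le_normc (a b : R) : `|a| <= ComplexField.Normc.normc (a +i* b)%C /\
   `|b| <= ComplexField.Normc.normc (a +i* b)%C.
  rewrite /ComplexField.Normc.normc -!sqrtr_sqr; split; apply: ler_wsqrtr;
  by rewrite ?lerDl ?lerDr sqr_ge0.
have c0 : 0 <= fine (component mu i B) by exact: fine_ge0.
rewrite /radon_val; case: i own opp fB c0 {le_normc} (le_normc) => -[] [] /= _;
  rewrite /component /real_component /= => -> _ c0 nc;
  rewrite ?subr0 ?sub0r.
- by apply: le_trans (nc _ _).2; rewrite normrN ger0_norm.
- by apply: le_trans (nc _ _).2; rewrite ger0_norm.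
- by apply: le_trans (nc _ _).1; rewrite normrN ger0_norm.
- by apply: le_trans (nc _ _).1; rewrite ger0_norm.
Qed.

Lemma M_infty_mass (R : realType) (rho : R -> R) (mu : radon R) :
  M_infty rho mu -> exists M : R, 0 <= M /\ forall i r, 1 <= r ->
    (component mu i `[r, (expR 1 * r)%R]%classic <= (M * V rho r)%:E)%E.
Proof.
rewrite /M_infty /=; set S := [set _ | _ in _] => Sfin.
have [M [M0 SM]] : exists M : R, 0 <= M /\ forall z, S z -> (z <= M%:E)%E.
  exists (fine (maxe (ereal_sup S) 0%E)).
  have mfin : maxe (ereal_sup S) 0%E \is a fin_num.
    by rewrite ge0_fin_numE ?le_max ?lexx ?orbT// gt_max Sfin ltry.
  split; first by rewrite fine_ge0// le_max lexx orbT.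
  by move=> z Sz; rewrite fineK// le_max ereal_sup_ubound.
exists M; split=> // i r r1; have r0 : 0 < r by rewrite (lt_le_trans ltr01).
apply: (le_trans (component_le_total_variation _ _ _ r0)).
have Vr := V_gt0 rho r0.
have := SM _ (ex_intro2 _ _ r _ erefl); rewrite /= in_itv/= andbT => /(_ r1).
by rewrite lee_pdivrMr// -EFinM.
Qed.

(** [a r, b r] is covered by the intervals [a e^k r, a e^(k+1) r], to each of
    which the growth condition applies as soon as [a e^k r >= 1]. *)
Lemma component_growth (R : realType) (rho : R -> R) (mu : radon R)
    (i : bool * bool) (a b : R) :
  proximate_order rho -> M_infty rho mu -> 0 < a ->
  exists M r0 : R, 0 < r0 /\ forall r, r0 <= r ->
    (component mu i `[(a * r)%R, (b * r)%R]%classic <= (M * V rho r)%:E)%E.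
Proof.
move=> rhoP /M_infty_mass[M [M0 mM]] a0.
have step n : exists M' r0 : R, 0 < r0 /\ forall r, r0 <= r ->
    (component mu i `[(a * r)%R, (a * expR n%:R * r)%R]%classic <= (M' * V rho r)%:E)%E.
  elim: n => [|n [M1 [r1 [r10 IH]]]].
    have [M2 [r2 [r20 V2]]] := proximate_dilation_bound rhoP a0.
    exists (M * M2), (r2 + a^-1).
    have a'0 : 0 < a^-1 by rewrite invr_gt0.
    split; first exact: addr_gt0.
    move=> r hr; have r2r : r2 <= r by rewrite (le_trans _ hr)// lerDl ltW.
    have ar1 : 1 <= a * r.
      by rewrite mulrC -ler_pdivrMr// div1r (le_trans _ hr)// lerDr ltW.
    apply: (@le_trans _ _ (M * V rho (a * r))%:E); last first.
      by rewrite lee_fin -[leRHS]mulrA ler_wpM2l// V2.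
    apply: le_trans (mM i _ ar1); apply: le_measure; rewrite ?inE//.
    apply: subset_itvl; rewrite bnd_simp expR0 mulr1 ler_peMl//.
      by rewrite (le_trans ler01).
    by rewrite -expR0 ler_expR.
  have an0 : 0 < a * expR n%:R by rewrite mulr_gt0// expR_gt0.
  have [M2 [r2 [r20 V2]]] := proximate_dilation_bound rhoP an0.
  exists (M1 + M * M2), (r1 + r2 + (a * expR n%:R)^-1).
  have an'0 : 0 < (a * expR n%:R)^-1 by rewrite invr_gt0.
  split; first by rewrite !addr_gt0.
  move=> r hr.
  have r1r : r1 <= r by lra.
  have r2r : r2 <= r by lra.
  have anr : (a * expR n%:R)^-1 <= r by lra.
  have anr1 : 1 <= a * expR n%:R * r by rewrite mulrC -ler_pdivrMr// div1r.
  rewrite mulrDl EFinD.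
  apply: (@le_trans _ _ (component mu i `[(a * r)%R, (a * expR n%:R * r)%R]%classic +
     component mu i `[(a * expR n%:R * r)%R, (expR 1 * (a * expR n%:R * r))%R]%classic)%E).
    apply: (@le_trans _ _ (component mu i (`[(a * r)%R, (a * expR n%:R * r)%R]%classic `|`
      `[(a * expR n%:R * r)%R, (expR 1 * (a * expR n%:R * r))%R]%classic))); last exact: measureU2.
    apply: le_measure; rewrite ?inE//; first exact: measurableU.
    move=> z /=; rewrite !in_itv/= -natr1 expRD => /andP[h1 h2].
    have [zl|zg] := leP z (a * expR n%:R * r); [left|right].
      by rewrite h1.
    by rewrite ltW//= (le_trans h2)// le_eqVlt; apply/orP; left; apply/eqP; ring.
  apply: leeD; first exact: IH.
  apply: (@le_trans _ _ (M * V rho (a * expR n%:R * r))%:E); first exact: mM.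
  by rewrite lee_fin -[leRHS]mulrA ler_wpM2l// V2.
have [M' [r0 [r00 Mr]]] := step (Num.bound `|b / a|).
exists M', r0; split=> // r hr; apply: le_trans (Mr r hr).
apply: le_measure; rewrite ?inE//; apply: subset_itvl; rewrite bnd_simp.
rewrite ler_wpM2r ?(le_trans (ltW r00))// -ler_pdivrMl// mulrC.
apply: (le_trans (ler_norm _)); apply: (@le_trans _ _ (Num.bound `|b / a|)%:R).
  by rewrite ltW// archi_boundP.
by rewrite (le_trans _ (expR_ge1Dx _))// lerDr.
Qed.

(** * Topology of the complex plane *)

Lemma normCplxE (R : realType) (z : Cplx R) :
  `|z| = (Num.sqrt (complex.Re z ^+ 2 + complex.Im z ^+ 2))%:C%C :> R[i].
Proof. by case: z. Qed.

Lemma abs_Re_le_norm (R : realType) (z : Cplx R) (e : R) :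
  `|z| < (e%:C)%C :> R[i] -> `|complex.Re z| < e.
Proof.
rewrite normCplxE ltcR; apply: le_lt_trans.
by rewrite -sqrtr_sqr ler_wsqrtr// lerDl sqr_ge0.
Qed.

Lemma abs_Im_le_norm (R : realType) (z : Cplx R) (e : R) :
  `|z| < (e%:C)%C :> R[i] -> `|complex.Im z| < e.
Proof.
rewrite normCplxE ltcR; apply: le_lt_trans.
by rewrite -sqrtr_sqr ler_wsqrtr// lerDr sqr_ge0.
Qed.

Lemma norm_le_ReIm (R : realType) (z : Cplx R) :
  `|z| <= (`|complex.Re z| + `|complex.Im z|)%:C%C :> R[i].
Proof.
rewrite normCplxE lecR -[leRHS]ger0_norm ?addr_ge0// -[leRHS]sqrtr_sqr ler_wsqrtr//.
rewrite sqrrD !real_normK ?num_real// -addrA lerD2l lerDr.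
by rewrite mulrn_wge0// mulr_ge0.
Qed.

(** The modulus, hence the radius [e] below, takes its values in [R[i]]; being
    positive, [e] is real. *)
Lemma cvg_CplxP (R : realType) (T : Type) (F : set_system T) (FF : Filter F)
    (u : T -> Cplx R) (z : Cplx R) :
  u @ F --> z <->
  ((fun t => complex.Re (u t)) @ F --> complex.Re z /\
   (fun t => complex.Im (u t)) @ F --> complex.Im z).
Proof.
split=> [uz|[rz iz]].
  split; apply/cvgrPdist_lt => e e0; have ec0 : 0 < (e%:C)%C :> R[i] by rewrite ltcR.
    move/cvgrPdist_lt : uz => /(_ _ ec0); apply: filterS => t /abs_Re_le_norm.
    by rewrite raddfB.
  move/cvgrPdist_lt : uz => /(_ _ ec0); apply: filterS => t /abs_Im_le_norm.
  by rewrite raddfB.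
apply/cvgrPdist_lt => e e0; pose r := complex.Re e.
have [r0 er] : 0 < r /\ e = (r%:C)%C.
  by move: e0; rewrite /r; case: (e) => a b; rewrite ltcE /= => /andP[/eqP -> ?].
have r20 : 0 < r / 2 by rewrite divr_gt0.
move/cvgrPdist_lt : rz => /(_ _ r20) rz; move/cvgrPdist_lt : iz => /(_ _ r20) iz.
near=> t; rewrite er; apply: le_lt_trans (norm_le_ReIm _) _.
rewrite ltcR (splitr r) ltrD// raddfB; near: t; [exact: rz|exact: iz].
Unshelve. all: by end_near. Qed.

Lemma Cplx_hausdorff (R : realType) : hausdorff_space (Cplx R).
Proof. exact: norm_hausdorff. Qed.

(** Closed squares are compact, as images of products of segments. *)
Lemma Cplx_locally_compact (R : realType) : locally_compact [set: Cplx R].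
Proof.
move=> z _; pose f (p : R * R) : Cplx R := (p.1 +i* p.2)%C.
pose a := complex.Re z; pose b := complex.Im z.
pose U := f @` (`[a - 1, a + 1] `*` `[b - 1, b + 1]).
have cU : compact U.
  apply: continuous_compact; last by apply: compact_setX; exact: segment_compact.
  apply: continuous_subspaceT => p; apply/cvg_CplxP; split.
    exact: cvg_fst.
  exact: cvg_snd.
exists U; last by split=> //; apply: compact_closed => //; exact: Cplx_hausdorff.
rewrite withinET.
have : nbhs z (ball z 1) by apply: nbhsx_ballx.
apply: filterS => w; rewrite -ball_normE /= => zw.
have := @abs_Re_le_norm R (z - w) 1 zw; have := @abs_Im_le_norm R (z - w) 1 zw.
rewrite !raddfB /= -/a -/b !ltr_norml => /andP[h1 h2] /andP[h3 h4].
exists (complex.Re w, complex.Im w); last by case: (w).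
by split=> /=; rewrite in_itv/=; apply/andP; split; lra.
Qed.

(** * Wide compactness of the dilated measures *)

Lemma bump_integrable (R : realType) (m : {measure set R -> \bar R})
    (phi : R -> R) :
  positive_radon m -> bump phi -> m.-integrable half_line (EFin \o phi).
Proof.
move=> [_ mC] phib; have mphi := bump_measurable phib.
have [cphi [C [cC C0 phi0]]] := phib.
have mh := @measurable_half_line R; have mC' := compact_measurable cC.
have phiE : {in half_line, EFin \o phi =1 (EFin \o phi) \_ C}.
  move=> x; rewrite inE half_lineE => x0; rewrite patchE; case: ifPn => //.
  by rewrite notin_setE /= => nCx; rewrite phi0.
apply: (eq_integrable mh ((EFin \o phi) \_ C)).
  by move=> x xh; rewrite -phiE.
apply/(integrable_restrict m mC' mh); rewrite setIC setIidl//.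
apply: measurable_bounded_integrable => //; first exact: mC.
  exact: measurable_funS mphi.
have cCphi : compact (phi @` C).
  apply: continuous_compact => //; apply: continuous_in_subspaceT => x.
  by rewrite inE => /C0; rewrite half_lineE => /cphi.
have [M [Mreal bM]] := compact_bounded cCphi.
exists M; split => // M' MM' z /= Cz.
by apply: (bM _ MM'); exists z.
Qed.

(** Change of variables [x = t u].  Integrability makes the positive and
    negative parts of the integral finite, so that the factor distributes. *)
Lemma Rintegral_azarin_pos (R : realType) (rho : R -> R) (t : R)
    (m : {measure set R -> \bar R}) (phi : R -> R) :
  0 < t -> positive_radon (azarin_pos rho t m) -> bump phi ->
  \int[azarin_pos rho t m]_(x in half_line) phi x =
  (V rho t)^-1 * \int[m]_(x in half_line) phi (x / t).
Proof.
move=> t0 mtR phib.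
have mh := @measurable_half_line R.
have mphi := bump_measurable phib.
have mphiE : measurable_fun half_line (EFin \o phi) by exact/measurable_EFinP.
have Vt := V_gt0 rho t0.
have intphi := bump_integrable mtR phib.
have <- : \int[dilation t m]_(x in half_line) phi x =
          \int[m]_(x in half_line) phi (x / t).
  apply: (eq_trans (Rintegral_image (measurable_divr t) m mh mphi)).
  congr (\int[_]_(x in _) _); apply/seteqP.
  by split=> x /=; rewrite !half_lineE pmulr_lgt0 ?invr_gt0.
have fp := integrable_pos_fin_num mh intphi.
have fn := integrable_neg_fin_num mh intphi.
move: fp fn; rewrite /Rintegral [in LHS]integralE [in RHS]integralE.
have mp := measurable_funepos mphiE; have mn := measurable_funeneg mphiE.
rewrite !(@ge0_integral_mscale _ _ _ (dilation t m) _ mh)//=.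
set A := (\int[_]_(_ in _) _)%E; set B := (\int[_]_(_ in _) _)%E.
have fin X : ((V rho t)^-1%:E * X)%E \is a fin_num -> X \is a fin_num.
  have V'0 : 0 < (V rho t)^-1 by rewrite invr_gt0.
  by case: X => // ; rewrite ?gt0_muley ?gt0_muleNy ?lte_fin.
move=> /fin /fineK <- /fin /fineK <-.
by rewrite -!EFinM -!EFinB /= mulrBr.
Qed.

Lemma component_azarin (R : realType) (rho : R -> R) (t : {posnum R})
    (mu : radon R) (i : bool * bool) :
  component (azarin rho t mu) i = azarin_pos rho t%:num (component mu i).
Proof. by case: i => -[] []. Qed.

Lemma radon_integralE (R : realType) (mu : radon R) (f : R -> Cplx R) :
  let S phi i := \int[component mu i]_(x in half_line) phi (f x) in
  radon_integral mu f =
  ((S (@complex.Re R) (false, false) - S (@complex.Re R) (false, true)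
    - (S (@complex.Im R) (true, false) - S (@complex.Im R) (true, true)))
  +i* (S (@complex.Im R) (false, false) - S (@complex.Im R) (false, true)
    + (S (@complex.Re R) (true, false) - S (@complex.Re R) (true, true))))%C.
Proof.
rewrite /radon_integral /real_integral /pos_integral /component /=.
by apply/eqP; rewrite eq_complex /=; apply/andP; split; apply/eqP; ring.
Qed.

Lemma test_function_bump (R : realType) (phi : R -> Cplx R) :
  test_function phi ->
  bump (fun x => complex.Re (phi x)) /\ bump (fun x => complex.Im (phi x)).
Proof.
move=> [cphi [C [cC C0 phi0]]].
split; split; [|exists C; split=> // x x0 Cx; by rewrite phi0|
                |exists C; split=> // x x0 Cx; by rewrite phi0].
  by move=> x x0; have /cvg_CplxP[] := cphi x x0.
by move=> x x0; have /cvg_CplxP[] := cphi x x0.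
Qed.

Lemma J_azarin (R : realType) (rho : R -> R) (mu : radon R)
    (K : R -> Cplx R) (t : {posnum R}) :
  test_function K ->
  J rho mu K t%:num = radon_integral (azarin rho t mu) K.
Proof.
move=> /test_function_bump[Kr Ki].
have SE i phi : bump phi ->
    \int[component (azarin rho t mu) i]_(x in half_line) phi x =
    (V rho t%:num)^-1 * \int[component mu i]_(x in half_line) phi (x / t%:num).
  move=> phib; have := component_radon (azarin rho t mu) i.
  by rewrite component_azarin => azR; exact: Rintegral_azarin_pos.
rewrite /J !radon_integralE (SE _ _ Kr) (SE _ _ Ki) !(SE _ _ Kr) !(SE _ _ Ki).
by apply/eqP; rewrite eq_complex /=; apply/andP; split; apply/eqP; ring.
Qed.

(** Restores the mutual singularity that wide limits may lose. *)
Lemma real_radon_difference (R : realType) (p n : {measure set R -> \bar R}) :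
  positive_radon p -> positive_radon n ->
  exists m : real_radon R, forall phi, bump phi ->
    \int[rpos m]_(x in half_line) phi x - \int[rneg m]_(x in half_line) phi x =
    \int[p]_(x in half_line) phi x - \int[n]_(x in half_line) phi x.
Proof.
move=> pR nR; have mh := @measurable_half_line R.
(* The complement of the half-line is null; adding it makes the [F k] cover the
   whole line. *)
pose F k : set R := `[k.+1%:R^-1, k.+1%:R]%classic `|` ~` half_line.
have mF k : measurable (F k) by apply: measurableU => //; exact: measurableC.
have FT : \bigcup_k F k = setT.
  rewrite -subTset => x _; have [x0|x0] := ltP 0 x; last first.
    by exists 0%N => //; right; rewrite /setC /= half_lineE; apply/negP; rewrite -leNgt.
  exists (Num.bound (x + x^-1)) => //; left; rewrite /= in_itv/=.
  have x'0 : 0 < x^-1 by rewrite invr_gt0.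
  have xb : x + x^-1 <= (Num.bound (x + x^-1)).+1%:R.
    by rewrite ltW// -natr1 ltr_wpDr// archi_boundP// addr_ge0// ltW.
  apply/andP; split; last by apply: (le_trans _ xb); rewrite lerDl ltW.
  rewrite -[leRHS]invrK lef_pV2 ?posrE ?ltr0n//.
  by apply: (le_trans _ xb); rewrite lerDr ltW.
have Ffin (m : {measure set R -> \bar R}) k : positive_radon m -> (m (F k) < +oo)%E.
  move=> [m0 mC]; rewrite measureU0//; last exact: measurableC.
  by apply: mC; [exact: segment_compact|apply: itvcc_half_line; rewrite invr_gt0].
have [k1 [k2 [k1p k2n sing bal]]] := jordan_difference mF FT
  (fun k => Ffin p k pR) (fun k => Ffin n k nR).
have below (k m : {measure set R -> \bar R}) : positive_radon m ->
    (forall E, measurable E -> (k E <= m E)%E) -> positive_radon k.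
  move=> [m0 mC] km; split=> [|C cC C0].
    by apply/eqP; rewrite -measure_le0 -m0 km//; exact: measurableC.
  by rewrite (le_lt_trans (km _ (compact_measurable cC)))// mC.
have k1R := below _ _ pR k1p; have k2R := below _ _ nR k2n.
exists (RealRadon k1R k2R sing) => phi phib /=.
have : (\int[measure_add p k2]_(x in half_line) (phi x)%:E =
        \int[measure_add n k1]_(x in half_line) (phi x)%:E)%E.
  by apply: eq_measure_integral => A mA _; rewrite /= /msum !big_ord_recr !big_ord0 /= !add0e bal.
have ip := bump_integrable pR phib; have i1 := bump_integrable k1R phib.
have in_ := bump_integrable nR phib; have i2 := bump_integrable k2R phib.
rewrite !integral_measure_add// => /(congr1 fine).
rewrite [LHS]fineD ?integrable_fin_num// [RHS]fineD ?integrable_fin_num//.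
rewrite /Rintegral; lra.
Qed.

Lemma bounded_of_near (R : realType) (x : nat -> \bar R) (M : R) :
  (forall n, x n \is a fin_num) -> (\forall n \near \oo, (x n <= M%:E)%E) ->
  exists M', forall n, (x n <= M'%:E)%E.
Proof.
move=> xfin [N _ xM]; pose S := \sum_(i < N) `|fine (x i)|.
exists (`|M| + S) => n; rewrite -(fineK (xfin n)) lee_fin.
have S0 : 0 <= S by exact: sumr_ge0.
have [Nn|nN] := leqP N n.
  have := xM n Nn; rewrite -(fineK (xfin n)) lee_fin => /le_trans; apply.
  by rewrite (le_trans (ler_norm _))// lerDl.
rewrite (le_trans (ler_norm _))// (@le_trans _ _ S)// ?lerDr//.
by rewrite /S (bigD1 (Ordinal nN))//= lerDl sumr_ge0.
Qed.

(** Wide sequential compactness of the dilated measures: the masses of a fixed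
    interval are bounded along [t n], so the four components converge along a
    common subsequence, and the limits are recombined into a Radon measure. *)
Lemma azarin_selection (R : realType) (rho : R -> R) (mu : radon R)
    (t : nat -> {posnum R}) :
  proximate_order rho -> M_infty rho mu ->
  (t n)%:num @[n --> \oo] --> +oo ->
  exists2 f : nat -> nat, (forall n, (f n < f n.+1)%N) &
    exists nu, wide_cvg (fun n => azarin rho (t (f n)) mu) nu.
Proof.
move=> rhoP muM tinf.
pose m i n := component (azarin rho (t n) mu) i.
have mR i n : positive_radon (m i n) by exact: component_radon.
have [|f fS sel] := @radon_selection R _ m mR.
  move=> i a b a0.
  have [M [r0 [r00 Mr]]] := component_growth i b rhoP muM a0.
  apply: (@bounded_of_near R _ M) => [n|].
    by apply: (radon_fin_num (mR i n) a0 (y := b)) => //; exact: measurable_itv.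
  have : \forall n \near \oo, r0 <= (t n)%:num by move/cvgryPge : tinf; exact.
  apply: filterS => n /Mr; rewrite /m component_azarin.
  have t0 : 0 < (t n)%:num by [].
  have Vt := V_gt0 rho t0.
  rewrite /azarin_pos /= /mscale /= /dilation /pushforward => h.
  rewrite muleC lee_pdivrMr// -EFinM.
  rewrite (_ : _ @^-1` _ = `[a * (t n)%:num, b * (t n)%:num]%classic)//.
  by apply/seteqP; split=> x /=; rewrite !in_itv/= ler_pdivlMr// ler_pdivrMr.
exists f => //.
have [p_ pR pcvg] : exists2 p : bool * bool -> {measure set R -> \bar R},
    (forall i, positive_radon (p i)) &
    forall i phi, bump phi -> \int[m i (f n)]_(x in half_line) phi x @[n --> \oo] -->
        \int[p i]_(x in half_line) phi x.
  have sel' i : {q : {measure set R -> \bar R} | positive_radon q /\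
      forall phi, bump phi -> \int[m i (f n)]_(x in half_line) phi x @[n --> \oo] -->
        \int[q]_(x in half_line) phi x}.
    by apply: cid; have [q qR qc] := sel i; exists q.
  exists (fun i => sval (sel' i)) => i; by case: (svalP (sel' i)).
have [nre nreE] := real_radon_difference (pR (false, false)) (pR (false, true)).
have [nim nimE] := real_radon_difference (pR (true, false)) (pR (true, true)).
exists (Radon nre nim) => phi /test_function_bump[rb ib].
have nuE := radon_integralE (Radon nre nim) phi; rewrite /component /= in nuE.
rewrite !nreE// !nimE// in nuE; rewrite nuE {nuE}.
under eq_cvg do rewrite radon_integralE.
apply/cvg_CplxP; split.
  exact: (cvgB (cvgB (pcvg (false, false) _ rb) (pcvg (false, true) _ rb))
               (cvgB (pcvg (true, false) _ ib) (pcvg (true, true) _ ib))).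
exact: (cvgD (cvgB (pcvg (false, false) _ ib) (pcvg (false, true) _ ib))
             (cvgB (pcvg (true, false) _ rb) (pcvg (true, true) _ rb))).
Qed.

Lemma increasing_subseq_cvg (f : nat -> nat) :
  (forall n, (f n < f n.+1)%N) -> f n @[n --> \oo] --> \oo.
Proof.
move=> fS; have fn n : (n <= f n)%N.
  by elim: n => // n IH; exact: leq_ltn_trans IH (fS n).
move=> A [N _ NA]; exists N => // n /= Nn; apply: NA => /=.
exact: leq_trans (fn n).
Qed.

(** * Limit set of J *)

Theorem theorem4p1 (R : realType) (rho : R -> R) (mu : radon R)
    (K : R -> Cplx R) (a b : R) :
  proximate_order rho ->
  M_infty rho mu ->
  (forall x, 0 < x -> {for x, continuous K}) ->
  0 < a -> a <= b ->
  (forall x, 0 < x -> K x != 0 -> a <= x <= b) ->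
  limit_set (J rho mu K) =
  [set Some (radon_integral nu K) | nu in Fr rho mu].
Proof.
move=> rhoP muM cK a0 _ suppK.
have KT : test_function K.
  split=> //; exists `[a, b]%classic; split.
  - exact: segment_compact.
  - exact: itvcc_half_line.
  - move=> x x0 nab; apply/eqP; apply: contrapT => /negP /(suppK _ x0) xab.
    by apply: nab; rewrite /= in_itv.
have someC := @one_point_compactification_some_continuous (Cplx R).
apply/seteqP; split=> [z [r [r0 rinf Jz]]|_ [nu [t [tinf tnu]] <-]].
- pose t n : {posnum R} := PosNum (r0 n).
  have [f fS [nu fnu]] := azarin_selection rhoP muM (t := t) rinf.
  have finf := increasing_subseq_cvg fS.
  exists nu.
    exists (t \o f); split; last exact: fnu.
    exact: cvg_comp finf rinf.
  (* [z] and the finite value are both limits of the same subsequence, in a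
     Hausdorff space. *)
  have haus : hausdorff_space (one_point_compactification (Cplx R)).
    apply: one_point_compactification_hausdorff.
      exact: Cplx_locally_compact.
    exact: Cplx_hausdorff.
  have JK : J rho mu K (r (f n)) @[n --> \oo] --> radon_integral nu K.
    have := fnu K KT; apply: cvg_trans; apply: near_eq_cvg.
    by near=> n; rewrite -J_azarin.
  have SJK := cvg_comp _ _ JK (someC _).
  exact: (cvg_unique haus SJK (cvg_comp _ _ finf Jz)).
- exists (fun n => (t n)%:num); split=> //.
  have JK : J rho mu K (t n)%:num @[n --> \oo] --> radon_integral nu K.
    have := tnu K KT; apply: cvg_trans; apply: near_eq_cvg.
    by near=> n; rewrite -J_azarin.
  exact: (cvg_comp _ _ JK (someC _)).
Unshelve. all: by end_near. Qed.
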